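(* Let $q=\{q_n\}_{n\geq1}$ be an (infinite) system of Beurling primes with $q_1>1$ and $\sigma_c(\zeta_q)<\infty$. Then for every $A>0$ there exists a system of Beurling primes $\tilde q=\{\tilde q_n\}_{n\geq1}$ such that $$|q_n-\tilde q_n|\leq q_n^{-A},\qquad n\in\mathbb{N},$$ and the Beurling integers $\{\tilde\nu_n\}_{n\geq1}$ generated by $\tilde q$ satisfy Bohr's condition: there exist $c_1,c_2>0$ with $\tilde\nu_{n+1}-\tilde\nu_n\geq c_1\tilde\nu_{n+1}^{-c_2}$ for all $n\in\mathbb{N}$.
   Context: A system of Beurling primes is an increasing sequence $q=\{q_n\}$ of real numbers with $1<q_n\to\infty$ such that $\{\log q_n\}$ is linearly independent over $\mathbb{Q}$. The Beurling integers are all finite products of elements of $q$ (including $1$), listed in increasing order as $\nu_1<\nu_2<\cdots$. $\zeta_q(s)=\sum_{n\geq1}\nu_n^{-s}$ and $\sigma_c(\zeta_q)$ is its abscissa of convergence. *)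

(* Defs.v *)
From HB Require Import structures.
From mathcomp Require Import all_boot all_order all_algebra.
From mathcomp Require Import all_classical all_reals all_analysis.
Set Implicit Arguments. Unset Strict Implicit. Unset Printing Implicit Defensive.
Import Order.TTheory GRing.Theory Num.Theory.
Import numFieldNormedType.Exports.
Local Open Scope ring_scope.

(* A system of Beurling primes, indexed from 0 (q 0 is q_1 of the paper):
   strictly increasing, all > 1, tending to +oo, and {ln (q n)} linearly
   independent over Q. *)
Definition beurling_primes (R : realType) (q : nat -> R) : Prop :=
  [/\ (forall n, q n < q n.+1),
      (forall n, 1 < q n),
      (forall M : R, exists N : nat, forall n, (N <= n)%N -> M < q n) &
      (forall (n : nat) (c : 'I_n -> rat),
          \sum_(i < n) ratr (c i) * ln (q i) = 0 -> forall i, c i = 0)].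

Definition beurling_int (R : realType) (q : nat -> R) (x : R) : Prop :=
  exists s : seq nat, x = \prod_(i <- s) q i.

(* nu lists the Beurling integers of q in increasing order: nu 0 < nu 1 < ...
   (nu n is the paper's nu_{n+1}). *)
Definition enum_beurling_ints (R : realType) (q : nat -> R) (nu : nat -> R)
  : Prop :=
  (forall n, nu n < nu n.+1) /\
  (forall x, beurling_int q x <-> exists n, nu n = x).

Definition zeta_converges_at (R : realType) (nu : nat -> R) (s : R) : Prop :=
  cvgn (series (fun k => nu k `^ (- s))).

Definition abscissa_finite (R : realType) (q : nat -> R) : Prop :=
  exists nu, enum_beurling_ints q nu /\ exists s : R, zeta_converges_at nu s.

Definition bohr_condition (R : realType) (nu : nat -> R) : Prop :=
  exists c1 c2 : R, 0 < c1 /\ 0 < c2 /\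
    forall n, c1 * nu n.+1 `^ (- c2) <= nu n.+1 - nu n.

(* Main.v *)
(** Each q_n is moved down into an interval J_n = [p_n, p_n + r_n] with
    r_n = eps q_n^-m and p_n = q_n - (r_n + r_{n+1} + ...); these intervals are
    consecutive, so the order is kept, and the displacement is at most q_n^-A
    once m exceeds A plus an exponent at which zeta_q converges. The points
    x_n in J_n are chosen one after the other so that, for all monomials a, b in
    x_0, ..., x_{n-1} and all k >= 1,
      |x_n^k a - b| >= c (x_n^k a b)^-C,  C = 2m.
    For given k, a, b the bad x_n lie in an interval of length O(c (p_n^k a b)^-C),
    and an Euler product bounds the sum of these lengths by O(c p_n^-C) <= O(c q_n^-m)
    uniformly in n, which is less than r_n for small c. Cancelling the common
    power of the largest prime extends the inequality to
    any two distinct monomials, which gives both the linear independence of the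
    logarithms and Bohr's condition. *)
Require Import Defs.
From HB Require Import structures.
From mathcomp Require Import all_boot all_order all_algebra.
From mathcomp Require Import all_classical all_reals all_analysis.
From mathcomp Require Import ring lra zify.
Set Implicit Arguments. Unset Strict Implicit. Unset Printing Implicit Defensive.
Import Order.TTheory GRing.Theory Num.Theory.
Import numFieldNormedType.Exports.
Local Open Scope ring_scope.

(** * Avoiding countably many small sets, by Lebesgue measure *)

(** Each [A t] lies in an interval of length [2 * rho t] centred at one of its points; by countable
    subadditivity, a total length of at most [b < r] cannot cover [[p, p + r]]. *)
Lemma avoid_countably_many (R : realType) (T : countType) (A : T -> set R)
    (rho : T -> R) (p r b : R) :
  (forall t, 0 <= rho t) ->
  (forall t x y, A t x -> A t y -> `|x - y| <= rho t) ->
  (forall s : seq T, uniq s -> \sum_(t <- s) 2 * rho t <= b) ->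
  0 <= r -> b < r ->
  exists y, p <= y <= p + r /\ forall t, ~ A t y.
Proof.
move=> rho0 diamA sum_rho r0 ltbr.
pose J : interval R := `[p, p + r].
(* The default [p] occurs only for an empty [A t], where any centre will do. *)
pose ctr t := xget p (A t).
pose I t : interval R := `[ctr t - rho t, ctr t + rho t].
have muI t : lebesgue_measure [set` I t]%classic = (2 * rho t)%:E.
  rewrite lebesgue_measure_itv /= lte_fin.
  case: ifP => [_|]; first by rewrite -EFinB; congr EFin; ring.
  by have := rho0 t => h0 /negbT; rewrite -leNgt => h1; congr EFin; lra.
have subI t : (A t `<=` [set` I t])%classic.
  move=> x Ax /=; rewrite in_itv /=.
  have /= Ac : A t (ctr t) by exact: xgetPex (ex_intro _ x Ax).
  by have := diamA _ _ _ Ax Ac; rewrite ler_norml; lra.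
have muJ : lebesgue_measure [set` J]%classic = r%:E.
  rewrite lebesgue_measure_itv /= lte_fin.
  case: ifP => [_|]; first by rewrite -EFinB; congr EFin; ring.
  by move=> /negbT; rewrite -leNgt => h1; congr EFin; lra.
pose F n : set R := oapp (fun t : T => [set` I t]%classic) set0 (pickle_inv n).
have mF n : measurable (F n).
  by rewrite /F; case: pickle_inv => [t|] /=; [exact: measurable_itv|exact: measurable0].
have muF n : lebesgue_measure (F n)
           = (oapp (fun t : T => 2 * rho t) 0 (pickle_inv n))%:E.
  by rewrite /F; case: pickle_inv => [t|] /=; [exact: muI|exact: measure0].
apply: contrapT => none.
have cover : ([set` J] `<=` \bigcup_n F n)%classic.
  move=> y /=; rewrite in_itv /= => Jy; apply: contrapT => ncov; apply: none.
  exists y; split=> // t At; apply: ncov; exists (pickle t) => //.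
  by rewrite /F pickleK_inv; exact: subI.
have := measure_sigma_subadditive (@lebesgue_measure R) mF (measurable_itv J) cover.
rewrite [X in (X <= _)%E](_ : _ = r%:E); last exact: muJ.
apply/negP; rewrite -ltNge; apply: (@le_lt_trans _ _ b%:E); last by rewrite lte_fin.
apply: lime_le; first by apply: is_cvg_nneseries => n _ _; exact: measure_ge0.
apply: nearW => N; rewrite (eq_bigr _ (fun n _ => muF n)) sumEFin lee_fin.
rewrite -(big_pmap (op := +%R) (@pickle_inv T) (fun t => 2 * rho t)).
by apply: sum_rho; apply: (pmap_uniq (@pickle_invK T)); exact: iota_uniq.
Qed.

(** * Sums of monomials and Euler products *)

Lemma sum_geometric_le (R : realFieldType) (w : R) (N : nat) :
  0 <= w < 1 -> \sum_(j < N) w ^+ j <= (1 - w)^-1.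
Proof.
move=> /andP[w0 w1]; have w1' : 0 < 1 - w by lra.
have e : (1 - w) * \sum_(j < N) w ^+ j = 1 - w ^+ N.
  have := subrX1 w N; set S := \sum_(i < N) _ => h.
  by rewrite -[1 - w ^+ N]opprB h; ring.
rewrite -[leRHS]mul1r ler_pdivlMr // mulrC e.
by have := exprn_ge0 N w0; lra.
Qed.

(* Expanding the product of the geometric series, as in an Euler product. *)
Lemma sum_monomials_le (R : realFieldType) (X : finType) (w : X -> R)
    (s : seq {ffun X -> nat}) :
  (forall x, 0 <= w x < 1) -> uniq s ->
  \sum_(g <- s) \prod_x w x ^+ g x <= \prod_x (1 - w x)^-1.
Proof.
move=> w01 us.
have [N boundN] : exists N, forall g, g \in s -> forall x, (g x < N)%N.
  exists (\max_(g <- s) \max_x (g x)).+1 => g gs x; rewrite ltnS.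
  apply: leq_trans (leq_bigmax_seq _ gs erefl).
  exact: (leq_bigmax (F := fun x => g x)).
(* If [N = 0] and [s] is nonempty, then [X] is empty and both sides are 1. Otherwise [s] embeds into
   a finite box of exponents, over which the sum factors. *)
case: N boundN => [|N] boundN.
  have -> : \sum_(g <- s) \prod_x w x ^+ g x = \sum_(g <- s) 1.
    rewrite !big_seq; apply: eq_bigr => g gs; rewrite big1 // => x _.
    by have := boundN g gs x.
  case: s us boundN => [|g s] us boundN.
    by rewrite big_nil prodr_ge0 // => x _; rewrite invr_ge0; have := w01 x; lra.
  have noX (x : X) : False by have := boundN g (mem_head _ _) x.
  have -> : s = [::].
    case: s us {boundN} => // g' s /= /andP[+ _]; rewrite inE negb_or => /andP[/eqP + _].
    by case; apply/ffunP => x; case: (noX x).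
  by rewrite big_seq1 big1 // => x _; case: (noX x).
pose h (f : {ffun X -> 'I_N.+1}) : {ffun X -> nat} := [ffun x => f x : nat].
have hinj : injective h.
  move=> f f' /ffunP e; apply/ffunP => x; apply: val_inj.
  by have := e x; rewrite !ffunE.
have sub : {subset s <= [seq h f | f : {ffun X -> 'I_N.+1}]}.
  move=> g gs; apply/mapP; exists [ffun x => inord (g x)]; first by rewrite mem_enum.
  by apply/ffunP => x; rewrite !ffunE inordK // boundN.
have mono0 (g : {ffun X -> nat}) : 0 <= \prod_x w x ^+ g x.
  by apply: prodr_ge0 => x _; apply: exprn_ge0; case/andP: (w01 x).
apply: (@le_trans _ _ (\sum_(g <- [seq h f | f : {ffun X -> 'I_N.+1}]) \prod_x w x ^+ g x)).
  rewrite [leRHS](bigID (mem s)) /= -[leLHS]addr0; apply: lerD; last first.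
    by apply: sumr_ge0 => g _; exact: mono0.
  rewrite -[leRHS]big_filter le_eqVlt; apply/orP; left; apply/eqP/perm_big.
  apply: uniq_perm => //.
    by rewrite filter_uniq // map_inj_uniq // enum_uniq.
  move=> g; rewrite mem_filter; apply/idP/andP => [gs|[]//].
  by split=> //; exact: sub.
rewrite big_image /=.
under eq_bigr do under eq_bigr do rewrite ffunE.
rewrite -(bigA_distr_bigA (fun x (j : 'I_N.+1) => w x ^+ j)).
apply: ler_prod => x _; rewrite sum_geometric_le // andbT.
by apply: sumr_ge0 => j _; apply: exprn_ge0; case/andP: (w01 x).
Qed.

(** * Separation of monomials *)

Definition monomial (R : realType) (x : nat -> R) (n : nat) (e : nat -> nat) : R :=
  \prod_(i < n) x i ^+ e i.

Lemma monomial_ge1 (R : realType) (x : nat -> R) (n : nat) (e : nat -> nat) :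
  (forall i, (i < n)%N -> 1 <= x i) -> 1 <= monomial x n e.
Proof.
move=> x1; apply: (big_ind (fun z : R => 1 <= z)) => // [a b|i _].
  exact: mulr_ege1.
by apply: exprn_ege1; exact: x1.
Qed.

Lemma ler_invX (R : realFieldType) (C : nat) (a b : R) :
  0 < a -> a <= b -> b ^- C <= a ^- C.
Proof.
move=> a0 ab; have b0 : 0 < b by exact: lt_le_trans ab.
by rewrite lef_pV2 ?posrE ?exprn_gt0 // lerXn2r // ?nnegrE ltW.
Qed.

(** The cofactor of [y - z] in [y ^+ k.+1 - z ^+ k.+1] is a sum of nonnegative terms, one of them
    [y ^+ k >= 1]. Hence prescribing [y ^+ k.+1 * a] to within [eta] confines [y] to a set of
    diameter at most [2 * eta]. *)
Lemma ler_dist_expM (R : realFieldType) (a y z : R) (k : nat) :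
  1 <= a -> 1 <= y -> 1 <= z ->
  `|y - z| <= `|y ^+ k.+1 * a - z ^+ k.+1 * a|.
Proof.
move=> a1 y1 z1; rewrite -mulrBl normrM subrXX normrM -mulrA.
apply: ler_peMr => //; apply: mulr_ege1; last by rewrite ger0_norm //; lra.
rewrite ger0_norm; last first.
  by apply: sumr_ge0 => i _; apply: mulr_ge0; apply: exprn_ge0; lra.
rewrite big_ord_recl /=.
have h : 1 <= y ^+ k.+1.-1 * z ^+ 0 by rewrite expr0 mulr1 exprn_ege1.
apply: le_trans h _; rewrite ?subn0 lerDl.
by apply: sumr_ge0 => i _; apply: mulr_ge0; apply: exprn_ge0; lra.
Qed.

(** The bad sets are indexed by [k] and two exponent vectors. Their sizes sum to an Euler product
    with one factor for [p] and each [x i] occurring twice, whence [Z ^+ 2]. *)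
Lemma exists_separated (R : realType) (x : nat -> R) (n C : nat) (c p r Z : R) :
  (forall i, (i < n)%N -> 1 < x i) -> 1 < p -> (0 < C)%N -> 0 < c -> 0 <= r ->
  \prod_(i < n) (1 - x i ^- C)^-1 <= Z ->
  4 * c * (p ^- C * (1 - p ^- C)^-1 * Z ^+ 2) < r ->
  exists y, p <= y <= p + r /\
    forall k e f,
      c * (y ^+ k.+1 * monomial x n e * monomial x n f) ^- C
        <= `|y ^+ k.+1 * monomial x n e - monomial x n f|.
Proof.
move=> x1 p1 C0 c0 r0 leZ ltr.
have inv01 (a : R) : 1 < a -> 0 <= a ^- C < 1.
  move=> a1; have a0 : 0 < a by lra.
  rewrite invr_ge0 exprn_ge0 ?(ltW a0) //= invf_lt1 ?exprn_gt0 //.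
  by rewrite exprn_egt1 // -lt0n.
have mono1 e : 1 <= monomial x n e by apply: monomial_ge1 => i /x1 /ltW.
pose X : finType := ('I_1 + ('I_n + 'I_n))%type.
pose w (t : X) : R := match t with
  | inl _ => p ^- C | inr (inl i) => x i ^- C | inr (inr i) => x i ^- C end.
have w01 t : 0 <= w t < 1 by case: t => [?|[i|i]] /=; apply: inv01 => //; exact: x1.
pose lft (g : {ffun X -> nat}) (i : nat) : nat :=
  if insub i is Some j then g (inr (inl j)) else 0%N.
pose rgt (g : {ffun X -> nat}) (i : nat) : nat :=
  if insub i is Some j then g (inr (inr j)) else 0%N.
have wE (g : {ffun X -> nat}) : \prod_t w t ^+ g t =
   (p ^+ g (inl ord0) * monomial x n (lft g) * monomial x n (rgt g)) ^- C.
  rewrite big_sumType big_sumType /= big_ord1 mulrA !exprMn !invfM.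
  have expVM (a : R) m : (a ^- C) ^+ m = (a ^+ m) ^- C.
    by rewrite -!exprVn -!exprM mulnC.
  rewrite expVM /monomial -!prodrXl -!prodfV. congr (_ * _ * _).
  - by apply: eq_bigr => i _; rewrite /lft valK -expVM.
  - by apply: eq_bigr => i _; rewrite /rgt valK -expVM.
(* The tolerance is taken at [p] so as not to depend on [y]; the extra [p ^- C] accounts for the
   exponent being [k.+1]. *)
pose eta (g : {ffun X -> nat}) := c * p ^- C * \prod_t w t ^+ g t.
have eta0 g : 0 <= eta g.
  rewrite /eta mulr_ge0 //; last first.
    by apply: prodr_ge0 => t _; apply: exprn_ge0; case/andP: (w01 t).
  by apply: mulr_ge0; [exact: ltW|case/andP: (inv01 _ p1)].
pose A (g : {ffun X -> nat}) : set R := [set y : R | p <= y /\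
  `|y ^+ (g (inl ord0)).+1 * monomial x n (lft g) - monomial x n (rgt g)| < eta g]%classic.
have diamA g y z : A g y -> A g z -> `|y - z| <= 2 * eta g.
  move=> [py Ay] [pz Az].
  have := @ler_dist_expM R (monomial x n (lft g)) y z (g (inl ord0)) (mono1 _).
  move=> /(_ _ _)/le_trans; apply; [lra|lra|].
  set b := monomial x n (rgt g) in Ay Az.
  have := ler_distD b (y ^+ (g (inl ord0)).+1 * monomial x n (lft g))
    (z ^+ (g (inl ord0)).+1 * monomial x n (lft g)).
  by move/le_trans; apply; rewrite [X in _ + X]distrC; lra.
have [||y [py notA]] := @avoid_countably_many R {ffun X -> nat} A
   (fun g => 2 * eta g) p r _ _ diamA _ r0 ltr.
- by move=> g; have := eta0 g; lra.
- move=> s us.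
  (* One factor 2 comes from the diameter bound, the other from the covering interval. *)
  have -> : \sum_(t <- s) 2 * (2 * eta t)
     = 4 * c * (p ^- C * \sum_(t <- s) \prod_u w u ^+ t u).
    rewrite !mulr_sumr; apply: eq_bigr => t _; rewrite /eta; ring.
  rewrite ler_pM2l; last by lra.
  rewrite -[leRHS]mulrA ler_pM2l ?invr_gt0 ?exprn_gt0 //; last by lra.
  apply: le_trans (sum_monomials_le w01 us) _.
  rewrite big_sumType big_sumType /= big_ord1.
  rewrite ler_pM2l; last by rewrite invr_gt0; have := inv01 _ p1; lra.
  have P0 : 0 <= \prod_(i < n) (1 - x i ^- C)^-1.
    by apply: prodr_ge0 => i _; rewrite invr_ge0; have := inv01 _ (x1 i (ltn_ord i)); lra.
  by rewrite expr2 ler_pM.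
exists y; split=> // k e f.
pose g : {ffun X -> nat} := [ffun t : X => match t with
  | inl _ => k | inr (inl i) => e i | inr (inr i) => f i end].
have ge : monomial x n (lft g) = monomial x n e.
  by apply: eq_bigr => i _; rewrite /lft valK ffunE.
have gf : monomial x n (rgt g) = monomial x n f.
  by apply: eq_bigr => i _; rewrite /rgt valK ffunE.
rewrite leNgt; apply/negP => ylt; apply: (notA g); split; first by case/andP: py.
have gk : g (inl ord0) = k by rewrite ffunE.
(* As [p <= y], the tolerance at [y] is at most [eta g]. *)
apply: lt_le_trans (_ : c * (y ^+ k.+1 * monomial x n e * monomial x n f) ^- C <= _).
  by rewrite ge gf gk.
rewrite /eta wE ge gf gk -[leRHS]mulrA ler_pM2l // -invfM -exprMn 2!mulrA -exprS.
have me := mono1 e; have mf := mono1 f.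
have pk : 0 < p ^+ k.+1 by apply: exprn_gt0; lra.
apply: ler_invX; first by rewrite !mulr_gt0 //; lra.
rewrite ler_pM2r; last by lra.
rewrite ler_pM2r; last by lra.
by rewrite lerXn2r // ?nnegrE; lra.
Qed.

(** Induction on the number of variables. If the exponents of the last variable differ, dividing by
    its smaller power leaves an instance of the hypothesis; if they agree, the two vectors differ at
    an earlier variable. *)
Lemma separated_monomials (R : realType) (x : nat -> R) (C : nat) (c : R) :
  0 < c -> (forall i, 1 <= x i) ->
  (forall n k e f, c * (x n ^+ k.+1 * monomial x n e * monomial x n f) ^- C
        <= `|x n ^+ k.+1 * monomial x n e - monomial x n f|) ->
  forall n e f, (exists2 i, (i < n)%N & e i != f i) ->
    c * (monomial x n e * monomial x n f) ^- C
      <= `|monomial x n e - monomial x n f|.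
Proof.
move=> c0 x1 sep; elim=> [|n IH] e f [i] // ltin neq.
have mono1 m g : 1 <= monomial x m g by apply: monomial_ge1 => j _; exact: x1.
rewrite /monomial !big_ord_recr /= -!/(monomial _ _ _).
(* A common factor [b >= 1] only enlarges the difference. *)
have scale (a b d : R) : 1 <= b -> 1 <= a -> 1 <= d ->
    c * (a * d) ^- C <= `|a - d| -> c * (a * b * (d * b)) ^- C <= `|a * b - d * b|.
  move=> b1 a1 d1 h; rewrite -mulrBl normrM (ger0_norm (_ : 0 <= b)); last by lra.
  apply: le_trans (_ : c * (a * d) ^- C <= _).
    rewrite ler_pM2l //; apply: ler_invX; first by rewrite mulr_gt0; lra.
    rewrite mulrACA ler_peMr //; first by rewrite mulr_ge0; lra.
    exact: mulr_ege1.
  by apply: le_trans h _; apply: ler_peMr.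
have diff (e' f' : nat -> nat) : (f' n < e' n)%N ->
    c * (monomial x n e' * x n ^+ e' n * (monomial x n f' * x n ^+ f' n)) ^- C
      <= `|monomial x n e' * x n ^+ e' n - monomial x n f' * x n ^+ f' n|.
  move=> lt; have [k ->] : exists k, e' n = (k.+1 + f' n)%N.
    by exists (e' n - f' n).-1; lia.
  rewrite exprD [_ * (x n ^+ k.+1 * _)]mulrA; apply: scale => //; first exact: exprn_ege1.
    by rewrite mulr_ege1 // exprn_ege1.
  by rewrite [_ * x n ^+ _]mulrC; exact: sep.
case: (ltngtP (e n) (f n)) => [lt|lt|eq].
- by rewrite distrC [X in X ^- C]mulrC; exact: diff.
- exact: diff.
- rewrite eq; apply: scale => //; first exact: exprn_ege1.
  apply: IH; exists i => //; move: ltin; rewrite ltnS leq_eqVlt => /orP[/eqP ein|//].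
  by move: neq; rewrite ein eq eqxx.
Qed.

(** * Increasing enumeration of a locally finite set *)

Lemma exists_seq_min (R : realDomainType) (P : pred R) (l : seq R) :
  has P l -> exists m, P m /\ forall y, y \in l -> P y -> m <= y.
Proof.
elim: l => // a l IH /=.
case hl: (has P l); last first.
  rewrite orbF => Pa; exists a; split=> // y; rewrite inE => /orP[/eqP->//|yl] Py.
  by move/negbT/hasPn/(_ y yl): hl; rewrite Py.
have [m [Pm le_m]] := IH hl.
case Pa: (P a) => _; last first.
  by exists m; split=> // y; rewrite inE => /orP[/eqP->|/le_m//]; rewrite Pa.
have [le_am|lt_ma] := leP a m.
  exists a; split=> // y; rewrite inE => /orP[/eqP->//|yl Py].
  by apply: le_trans le_am _; exact: le_m.
exists m; split=> // y; rewrite inE => /orP[/eqP-> _|/le_m//].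
exact: ltW.
Qed.

(** [nu] starts at the minimum of [S] and iterates the successor map; local finiteness supplies the
    minima. *)
Lemma enum_locally_finite (R : realType) (S : R -> Prop) :
  (forall M, exists l : seq R, forall x, S x -> x <= M -> x \in l) ->
  (forall M, exists2 x, S x & M < x) ->
  exists nu : nat -> R,
    (forall n, nu n < nu n.+1) /\ (forall x, S x <-> exists n, nu n = x).
Proof.
move=> fin unb.
have minS (P : R -> Prop) x0 : (forall x, P x -> S x) -> P x0 ->
    exists m, P m /\ forall y, P y -> m <= y.
  move=> PS Px0; have [l hl] := fin x0.
  have [|m [/asboolP Pm le_m]] := @exists_seq_min R (fun x => `[< P x >]) l.
    by apply/hasP; exists x0; [apply: hl => //; exact: PS|apply/asboolP].
  exists m; split=> // y Py; have [le_y|lt_y] := leP y x0.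
    by apply: le_m; [apply: hl => //; exact: PS|apply/asboolP].
  apply: le_trans (ltW lt_y).
  by apply: le_m; [apply: hl => //; exact: PS|apply/asboolP].
have [nxt nxtP] : exists nxt : R -> R, forall x,
    (S (nxt x) /\ x < nxt x) /\ forall z, S z /\ x < z -> nxt x <= z.
  suff /choice[nxt nxtP] : forall x, exists y,
      (S y /\ x < y) /\ forall z, S z /\ x < z -> y <= z by exists nxt.
  move=> x.
  by have [x0 Sx0 lt_x] := unb x; apply: (minS _ x0) => // z [].
have [x0 Sx0 _] := unb 0.
have [m [Sm le_m]] := minS S x0 (fun _ => id) Sx0.
pose nu n := iter n nxt m.
have nuS n : S (nu n) by case: n => [|n] //=; have [[]] := nxtP (nu n).
have nu_lt n : nu n < nu n.+1 by have [[]] := nxtP (nu n).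
exists nu; split=> // x; split=> [Sx|[n <-]//].
(* A missed [x] would exceed every [nu n], forcing [(size l).+1] distinct values into the list [l]
   that covers [S] up to [x]. *)
apply: contrapT => nex.
have nu_ltx n : nu n < x.
  elim: n => [|n IH]; rewrite lt_neqAle.
    by apply/andP; split; [apply/eqP => e; apply: nex; exists 0%N|exact: le_m].
  apply/andP; split; first by apply/eqP => e; apply: nex; exists n.+1.
  by have [_ /(_ x)] := nxtP (nu n); apply.
have [l hl] := fin x.
have nu_inj : injective nu.
  have mono := @homo_ltn _ nu _ lt_trans nu_lt.
  move=> i j e; case: (ltngtP i j) => // /mono; rewrite e; rewrite ?ltxx //.
suff : ((size l).+1 <= size l)%N by rewrite ltnn.
rewrite -[X in (X <= _)%N](size_mkseq nu); apply: uniq_leq_size.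
  by rewrite map_inj_uniq // iota_uniq.
by move=> _ /mapP[n _ ->]; apply: hl => //; exact: ltW.
Qed.

Lemma exists_expr_gt (R : realType) (a M : R) : 1 < a -> exists n, M < a ^+ n.
Proof.
move=> a1; have h0 : 0 < a - 1 by lra.
pose n := Num.bound (M / (a - 1)); exists n.
have bern : 1 + n%:R * (a - 1) <= a ^+ n.
  elim: n => [|n IH]; first by rewrite mul0r addr0 expr0.
  have n0 : 0 <= n%:R :> R by [].
  rewrite exprS -natr1.
  apply: le_trans (_ : a * (1 + n%:R * (a - 1)) <= _).
    by have := mulr_ge0 n0 (mulr_ge0 (ltW h0) (ltW h0)); lra.
  by rewrite ler_pM2l //; lra.
apply: lt_le_trans bern; apply: ltr_wpDl => //.
rewrite -ltr_pdivrMr //; apply: le_lt_trans (ler_norm _) _.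
by have := @archi_boundP R `|M / (a - 1)| (normr_ge0 _); rewrite /n /Num.bound normr_id.
Qed.

(** * Beurling integers: enumeration, Bohr's condition, linear independence *)

Section BeurlingIntegers.
Variables (R : realType) (q : nat -> R).
Hypothesis q1 : forall i, 1 < q i.

Lemma prod_seq_ge1 (s : seq nat) : 1 <= \prod_(i <- s) q i.
Proof. by apply: (big_ind (fun z : R => 1 <= z)) => // *; [exact: mulr_ege1|exact: ltW]. Qed.

Lemma monomial_count (s : seq nat) (n : nat) :
  all (gtn n) s -> \prod_(i <- s) q i = monomial q n (fun i => count_mem i s).
Proof.
elim: s => [|a s IH] /=; first by rewrite big_nil /monomial big1.
move=> /andP[an /IH e]; rewrite big_cons e /monomial.
rewrite [RHS](bigD1 (Ordinal an)) //= [in LHS](bigD1 (Ordinal an)) //=.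
rewrite eqxx add1n exprS -!mulrA; congr (_ * (_ * _)).
apply: eq_bigr => i /eqP ia; rewrite [a == i](_ : _ = false) //.
by apply/eqP => ai; apply: ia; exact: val_inj.
Qed.

Hypothesis q_incr : forall n, q n < q n.+1.
Hypothesis q_infty : forall M : R, exists N : nat, forall n, (N <= n)%N -> M < q n.

(** A product at most [M] has all factors at most [M], hence indices below [N], and at most [K]
    factors since [q 0 ^+ K > M]. *)
Lemma beurling_int_locally_finite (M : R) :
  exists l : seq R, forall x, beurling_int q x -> x <= M -> x \in l.
Proof.
have [N hN] := q_infty M; have [K hK] := exists_expr_gt M (q1 0).
suff [l hl] : exists l : seq R, forall s, (size s <= K)%N -> all (gtn N) s ->
    \prod_(i <- s) q i \in l.
  exists l => _ [s ->] leM; apply: hl.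
    rewrite leqNgt; apply/negP => ltK.
    suff : q 0 ^+ K <= \prod_(i <- s) q i by move: leM hK; lra.
    apply: le_trans (_ : q 0 ^+ size s <= _).
      by apply: ler_weXn2l; [exact: ltW|exact: ltnW].
    elim: (s) => [|i t IH]; first by rewrite big_nil.
    rewrite big_cons exprS; apply: ler_pM => //.
    - by rewrite ltW ?(lt_trans _ (q1 0)).
    - by rewrite exprn_ge0 // ltW ?(lt_trans _ (q1 0)).
    by case: i => // i; exact/ltW/(@homo_ltn _ q _ lt_trans q_incr).
  apply/allP => i /= si; rewrite ltnNge; apply/negP => /hN.
  apply/negP; rewrite -leNgt; apply: le_trans leM.
  rewrite (perm_big _ (perm_to_rem si)) /= big_cons ler_peMr //.
    by rewrite ltW // (lt_trans _ (q1 i)).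
  exact: prod_seq_ge1.
elim: K {hK} => [|K [l IH]].
  by exists [:: 1] => s; rewrite leqn0 size_eq0 => /eqP-> _; rewrite big_nil inE.
exists (1 :: [seq q i * x | i <- iota 0 N, x <- l]) => -[|i s] /=.
  by rewrite big_nil inE eqxx.
rewrite ltnS => sK /andP[iN sN]; rewrite big_cons inE; apply/orP; right.
by apply/allpairsP; exists (i, \prod_(j <- s) q j); rewrite mem_iota; split=> //; exact: IH.
Qed.

Lemma exists_enum_beurling_ints : exists nu, enum_beurling_ints q nu.
Proof.
apply: enum_locally_finite; first exact: beurling_int_locally_finite.
move=> M; have [N /(_ N (leqnn N)) hN] := q_infty M.
by exists (q N) => //; exists [:: N]; rewrite big_seq1.
Qed.

Lemma bohr_of_separated (C : nat) (c : R) (nu : nat -> R) :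
  0 < c -> (0 < C)%N ->
  (forall n e f, (exists2 i, (i < n)%N & e i != f i) ->
    c * (monomial q n e * monomial q n f) ^- C
      <= `|monomial q n e - monomial q n f|) ->
  enum_beurling_ints q nu -> bohr_condition nu.
Proof.
move=> c0 C0 sep [nu_lt nuP]; exists c, (2 * C)%:R; split=> //; split.
  by rewrite ltr0n; lia.
move=> n; have lt := nu_lt n.
have [s es] : beurling_int q (nu n) by apply/nuP; exists n.
have [t et] : beurling_int q (nu n.+1) by apply/nuP; exists n.+1.
pose N := (\max_(i <- s ++ t) i).+1.
have ltN i : i \in s ++ t -> (i < N)%N by move=> h; rewrite ltnS; exact: leq_bigmax_seq.
have es' := es; have et' := et.
rewrite (@monomial_count s N) in es; last first.
  by apply/allP => i si; apply: ltN; rewrite mem_cat si.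
rewrite (@monomial_count t N) in et; last first.
  by apply/allP => i ti; apply: ltN; rewrite mem_cat ti orbT.
have neq : exists2 i, (i < N)%N & count_mem i s != count_mem i t.
  apply: contrapT => nex; move: lt; rewrite es et.
  suff -> : monomial q N (fun i => count_mem i s)
          = monomial q N (fun i => count_mem i t) by rewrite ltxx.
  apply: eq_bigr => i _; congr (_ ^+ _); apply/eqP/negPn/negP => ne.
  by apply: nex; exists i.
have := sep N _ _ neq; rewrite -es -et distrC (ger0_norm (_ : 0 <= nu n.+1 - nu n)); last by lra.
apply: le_trans; rewrite ler_pM2l //.
have nu1 : 1 <= nu n by rewrite es' prod_seq_ge1.
rewrite powRN powR_mulrn; last by lra.
rewrite exprM; apply: ler_invX; first by rewrite mulr_gt0 //; lra.
by rewrite expr2 ler_pM2r; lra.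
Qed.

(** Clearing denominators, splitting the integer coefficients into positive and negative parts and
    exponentiating turns a nontrivial relation into two equal monomials with different exponents. *)
Lemma lin_indep_of_separated :
  (forall n e f, (exists2 i, (i < n)%N & e i != f i) ->
     monomial q n e != monomial q n f) ->
  forall (n : nat) (c : 'I_n -> rat),
    \sum_(i < n) ratr (c i) * ln (q i) = 0 -> forall i, c i = 0.
Proof.
move=> sep n c sum0.
pose D : int := \prod_(i < n) denq (c i).
have D0 : D != 0 by apply/prodf_neq0 => i _; exact: denq_neq0.
have [z zP] : exists z : 'I_n -> int, forall i, (z i)%:~R = c i * D%:~R.
  exists (fun i => numq (c i) * \prod_(j < n | j != i) denq (c j)) => i.
  by rewrite /D [in RHS](bigD1 i) //= !intrM numqE mulrA.
have zsum : \sum_(i < n) (z i)%:~R * ln (q i) = 0.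
  transitivity (D%:~R * \sum_(i < n) ratr (c i) * ln (q i)); last by rewrite sum0 mulr0.
  rewrite mulr_sumr; apply: eq_bigr => i _; rewrite mulrA; congr (_ * _).
  have := congr1 (@ratr R) (zP i).
  by rewrite rmorphM /= !ratr_int mulrC.
have z0 i : z i = 0.
  apply: contrapT => /eqP zi.
  pose ext (u : int -> nat) (j : nat) : nat :=
    if insub j is Some k then u (z k) else 0%N.
  pose pos (m : int) : nat := if 0 <= m then `|m|%N else 0%N.
  pose neg (m : int) : nat := if 0 <= m then 0%N else `|m|%N.
  have posneg m : (pos m)%:R - (neg m)%:R = m%:~R :> R.
    rewrite /pos /neg; case: ifP => [m0|/negbT m0].
      by rewrite subr0 natr_absz ger0_norm.
    by rewrite sub0r natr_absz ltr0_norm ?ltNge // mulrNz opprK.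
  have ln_mono e : ln (monomial q n e) = \sum_(j < n) (e j)%:R * ln (q j).
    rewrite /monomial; elim: (n) e => [|k IH] e; first by rewrite !big_ord0 ln1.
    rewrite !big_ord_recr /= lnM ?IH; last 2 first.
    - by rewrite posrE prodr_gt0 // => j _; rewrite exprn_gt0 // (lt_trans _ (q1 j)).
    - by rewrite posrE exprn_gt0 // (lt_trans _ (q1 k)).
    by rewrite lnXn ?(lt_trans _ (q1 k)) // mulr_natl.
  have := sep n (ext pos) (ext neg); move=> /(_ _)/negP; apply.
    exists (i : nat) => //; rewrite /ext valK; apply: contra zi => /eqP e.
    by have := posneg (z i); rewrite e subrr => /esym/eqP; rewrite intr_eq0.
  have m0 e : monomial q n e \is Num.pos.
    by rewrite posrE (lt_le_trans (@ltr01 R)) // monomial_ge1 // => j _; exact: ltW.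
  apply/eqP; apply: (ln_inj (m0 _) (m0 _)); apply/eqP; rewrite -subr_eq0 !ln_mono.
  rewrite -sumrB; apply/eqP; rewrite -[RHS]zsum; apply: eq_bigr => j _.
  by rewrite -mulrBl /ext valK posneg.
move=> i; have := zP i; rewrite z0 => /esym/eqP; rewrite mulf_eq0 intr_eq0 (negbTE D0) orbF.
by move/eqP.
Qed.
End BeurlingIntegers.

(** * Summability over the primes, choice with history, a uniform Euler product bound *)

(** Primes are Beurling integers, so [nu j <= q j], and the sum is dominated by the zeta series at a
    point of convergence. *)
Lemma sum_primes_bounded (R : realType) (q : nat -> R) :
  (forall n, q n < q n.+1) -> (forall n, 1 < q n) -> abscissa_finite q ->
  exists (S : nat) (K : R), forall n, \sum_(j < n) q j ^- S <= K.
Proof.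
move=> q_incr q1 [nu [[nu_lt nuP] [s cvs]]].
have nu1 n : 1 <= nu n.
  by have [t ->] : beurling_int q (nu n); [apply/nuP; exists n|exact: prod_seq_ge1].
have qnu j : exists k, nu k = q j by apply/nuP; exists [:: j]; rewrite big_seq1.
have nu_le : increasing_seq nu by exact/increasing_seqP.
have nu_q j : nu j <= q j.
  elim: j => [|j IH]; have [k ek] := qnu 0%N.
    by rewrite -ek nu_le.
  have [m em] := qnu j.+1; rewrite -em nu_le.
  by rewrite ltnNge -nu_le em -ltNge (le_lt_trans IH).
pose S := Num.bound s; exists S, (limn (series (fun k => nu k `^ (- s)))) => n.
apply: le_trans (_ : series (fun k => nu k `^ (- s)) n <= _); last first.
  apply: nondecreasing_cvgn_le => //; apply: nondecreasing_series => k _ _.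
  exact: powR_ge0.
rewrite /series /= big_mkord; apply: ler_sum => j _.
apply: le_trans (_ : nu j ^- S <= _).
  by apply: ler_invX => //; apply: lt_le_trans (nu1 j).
rewrite -powR_mulrn -?powRN; last by apply: le_trans (nu1 j).
apply: ler_powR => //; rewrite lerN2 ltW //.
apply: le_lt_trans (ler_norm _) _.
by have := @archi_boundP R `|s| (normr_ge0 _); rewrite /S /Num.bound normr_id.
Qed.

(** [P] sees only the list of earlier values, so later choices cannot disturb it. *)
Lemma history_choice (T : choiceType) (d : T) (P : nat -> seq T -> T -> Prop) :
  (forall n (x : nat -> T), (forall i, (i < n)%N -> P i (mkseq x i) (x i)) ->
     exists y, P n (mkseq x n) y) ->
  exists x : nat -> T, forall n, P n (mkseq x n) (x n).
Proof.
move=> ex.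
pose next n s := xget d (P n s).
pose h := fix h n := if n is m.+1 then rcons (h m) (next m (h m)) else [::].
pose x n := next n (h n).
have hE n : h n = mkseq x n by elim: n => // n IH; rewrite mkseqS -IH.
exists x; elim/ltn_ind => n IH; have [y Py] := ex n x IH.
by rewrite {2}/x hE; exact: (xgetPex d (ex_intro _ y Py)).
Qed.

(** Each factor is [1 + w i / (1 - w i)], at most [expR (w i / (1 - v))]. *)
Lemma prod_inv1B_le (R : realType) (n : nat) (w : 'I_n -> R) (v K : R) :
  (forall i, 0 <= w i <= v) -> v < 1 -> \sum_i w i <= K ->
  \prod_i (1 - w i)^-1 <= expR (K / (1 - v)).
Proof.
move=> w0v v1 sumK.
apply: le_trans (_ : expR (\sum_i w i / (1 - v)) <= _); last first.
  by rewrite ler_expR -mulr_suml ler_pM2r // invr_gt0; lra.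
rewrite expR_sum; apply: ler_prod => i _; have /andP[wi0 wiv] := w0v i.
rewrite invr_ge0; apply/andP; split; first by lra.
apply: le_trans (expR_ge1Dx _).
have -> : (1 - w i)^-1 = 1 + w i / (1 - w i) by field; lra.
rewrite lerD2l ler_wpM2l // lef_pV2 ?posrE; lra.
Qed.

(** * Construction of the perturbed primes *)

Section Perturbation.
Variables (R : realType) (q : nat -> R) (M S : nat) (K : R).
Hypothesis q_incr : forall n, q n < q n.+1.
Hypothesis q1 : forall n, 1 < q n.
Hypothesis sumK : forall n, \sum_(j < n) q j ^- S <= K.
Hypothesis M0 : (0 < M)%N.

(** In [q j ^- m] the part [q j ^- M] controls the displacement and [q j ^- S] gives summability. *)
Let m := (M + S)%N.
(** The cap 1 serves the displacement bound; the other keeps [p n] at or above the midpoint of 1 and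
    [q n]. *)
Let delta : R := Num.min 1 ((q 0 - 1) / 2).
Let eps : R := delta / K.
Let r j : R := eps * q j ^- m.
Let T n : R := limn (series r) - series r n.
Let p n : R := q n - T n.

Let q_gt0 n : 0 < q n. Proof. by apply: lt_trans (q1 n). Qed.
Let q_mono i j : (i <= j)%N -> q i <= q j.
Proof. by have /increasing_seqP h := q_incr; rewrite h. Qed.
Let K_gt0 : 0 < K.
Proof. by apply: lt_le_trans (sumK 1); rewrite big_ord1 invr_gt0 exprn_gt0. Qed.
Let delta_gt0 : 0 < delta.
Proof. by rewrite lt_min ltr01 /=; have := q1 0; lra. Qed.
Let delta_le1 : delta <= 1. Proof. by rewrite ge_min lexx. Qed.
Let delta_leq n : 2 * delta <= q n - 1.
Proof.
have h : delta <= (q 0 - 1) / 2 by rewrite ge_min lexx orbT.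
by have := q_mono (leq0n n); lra.
Qed.
Let eps_gt0 : 0 < eps. Proof. exact: divr_gt0. Qed.
Let r_gt0 n : 0 < r n.
Proof. by rewrite mulr_gt0 // invr_gt0 exprn_gt0. Qed.
Let series_mono : nondecreasing_seq (series r).
Proof. by apply: nondecreasing_series => k _ _; exact: ltW. Qed.
Let qM_le1 n k : q n ^- k <= 1.
Proof. by rewrite invf_le1 ?exprn_gt0 // exprn_ege1 // ltW. Qed.

(** For [j >= n], [q j ^- M <= q n ^- M]; the factors [q j ^- S] sum to at most [K], and
    [eps * K = delta]. *)
Let series_tail n N : (n <= N)%N -> series r N - series r n <= delta * q n ^- M.
Proof.
move=> nN; rewrite /series /= (big_cat_nat _ nN) //= addrAC subrr add0r.
apply: le_trans (_ : eps * q n ^- M * \sum_(n <= j < N) q j ^- S <= _).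
  rewrite mulr_sumr !big_nat; apply: ler_sum => j /andP[nj _].
  rewrite -mulrA ler_pM2l // exprD invfM ler_wpM2r ?invr_ge0 ?exprn_ge0 ?(ltW (q_gt0 j)) //.
  by apply: ler_invX => //; exact: q_mono.
apply: le_trans (_ : eps * q n ^- M * K <= _).
  apply: ler_wpM2l; first by rewrite ltW // divr_gt0 ?exprn_gt0.
  apply: le_trans (sumK N); rewrite -(big_mkord xpredT (fun j => q j ^- S)).
  rewrite [leRHS](big_cat_nat _ nN) //= lerDr; apply: sumr_ge0 => j _.
  by rewrite invr_ge0 exprn_ge0 // ltW.
by rewrite mulrAC /eps divfK // gt_eqF.
Qed.

Let series_cvg : cvgn (series r).
Proof.
apply: nondecreasing_is_cvgn => //; exists (delta * q 0 ^- M) => _ [N _ <-].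
have s0 : series r 0 = 0 by rewrite /series /= big_geq.
by apply: le_trans (series_tail (leq0n N)); rewrite s0 subr0.
Qed.

Let T_ge0 n : 0 <= T n.
Proof. by rewrite subr_ge0; exact: nondecreasing_cvgn_le. Qed.
Let TS n : T n = r n + T n.+1.
Proof. by rewrite /T /series /= big_nat_recr //=; ring. Qed.
Let T_le n : T n <= delta * q n ^- M.
Proof.
rewrite lerBlDr; apply: limr_le; first exact: series_cvg.
by near=> N; rewrite -lerBlDr; apply: series_tail; near: N; exact: nbhs_infty_ge.
Unshelve. all: by end_near. Qed.
Let T_le_delta n : T n <= delta.
Proof. by apply: le_trans (T_le n) _; rewrite ler_piMr // ltW. Qed.
Let p_gt1 n : 1 < p n.
Proof. by rewrite /p; have := (T_le_delta n, delta_leq n, q1 n) => -[[]]; lra. Qed.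
(** The square of the midpoint [(q n + 1) / 2] exceeds [q n] by [((q n - 1) / 2) ^+ 2]. This is what
    makes the choice [C = 2m] work: [p n ^- C <= q n ^- m]. *)
Let p_sqr n : q n <= p n ^+ 2.
Proof.
have hp : (q n + 1) / 2 <= p n.
  by rewrite /p; have := T_le_delta n; have := delta_leq n; lra.
have h1 : 0 <= (p n - (q n + 1) / 2) * (p n + (q n + 1) / 2).
  by apply: mulr_ge0; have := q_gt0 n; lra.
have h2 := sqr_ge0 ((q n - 1) / 2).
have e : p n ^+ 2 = q n + (p n - (q n + 1) / 2) * (p n + (q n + 1) / 2)
  + ((q n - 1) / 2) ^+ 2 by field.
by rewrite e; lra.
Qed.

Lemma exists_separated_perturbation :
  exists (qt : nat -> R) (C : nat) (c : R),
    [/\ (0 < C)%N, 0 < c, (forall n, 1 < qt n) & (forall n, qt n < qt n.+1)] /\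
    [/\ (forall n, q n - 1 <= qt n),
        (forall n, `|q n - qt n| <= q n ^- M) &
        (forall n k e f,
           c * (qt n ^+ k.+1 * monomial qt n e * monomial qt n f) ^- C
             <= `|qt n ^+ k.+1 * monomial qt n e - monomial qt n f|)].
Proof.
have m0 : (0 < m)%N by rewrite /m addn_gt0 M0.
pose C := (2 * m)%N; pose v := q 0 ^- m.
have v1 : v < 1 by rewrite invf_lt1 ?exprn_gt0 // exprn_egt1 // -lt0n.
have powC y n : p n <= y -> 0 <= y ^- C <= q n ^- m.
  move=> py; have y0 : 0 < y by apply: lt_le_trans py; apply: lt_trans (p_gt1 n).
  rewrite invr_ge0 exprn_ge0 ?(ltW y0) //= exprM; apply: ler_invX => //.
  by apply: le_trans (p_sqr n) _; rewrite lerXn2r ?nnegrE // ?(ltW y0) // (le_trans _ (ltW (p_gt1 n))).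
have qv n : q n ^- m <= v by apply: ler_invX => //; exact: q_mono.
(* [Z] bounds the Euler products for every [n], since [x i ^- C <= q i ^- m <= q i ^- S] and the
   latter sum to at most [K]. *)
pose Z := expR (K / (1 - v)); have Z0 : 0 < Z by exact: expR_gt0.
(* With this [c] the bad sets at stage [n] have total length at most [r n / 2]. *)
pose c := eps * (1 - v) / (8 * Z ^+ 2).
have c0 : 0 < c.
  by apply: divr_gt0; apply: mulr_gt0; rewrite ?subr_gt0 ?exprn_gt0.
pose P n (s : seq R) y := p n <= y <= p n + r n /\ forall k e f,
   c * (y ^+ k.+1 * monomial (nth 0 s) n e * monomial (nth 0 s) n f) ^- C
        <= `|y ^+ k.+1 * monomial (nth 0 s) n e - monomial (nth 0 s) n f|.
have [x xP] : exists x : nat -> R, forall n, P n (mkseq x n) (x n).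
  apply: (history_choice 0) => n x xP.
  have xp i : (i < n)%N -> p i <= x i by move=> /xP[/andP[]].
  apply: (@exists_separated R _ n C c (p n) (r n) Z) => //.
  - by move=> i ltin; rewrite nth_mkseq //; apply: lt_le_trans (xp i ltin).
  - by rewrite muln_gt0.
  - exact: ltW.
  - under eq_bigr do rewrite nth_mkseq //.
    apply: prod_inv1B_le v1 _ => [i|].
      have /andP[-> h] := powC _ _ (xp i (ltn_ord i)).
      by apply: le_trans h _.
    apply: le_trans (sumK n); apply: ler_sum => i _.
    have /andP[_ h] := powC _ _ (xp i (ltn_ord i)); apply: le_trans h _.
    by rewrite exprD invfM ler_piMl ?qM_le1 // invr_ge0 exprn_ge0 // ltW.
  have /andP[pC0 pCq] := powC _ _ (lexx (p n)).
  have h1v : 0 < 1 - v by lra.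
  have h1p : 1 - v <= 1 - p n ^- C by have := qv n; lra.
  apply: le_lt_trans (_ : 4 * c * (q n ^- m * (1 - v)^-1 * Z ^+ 2) < _).
    apply: ler_wpM2l; first by apply: mulr_ge0 => //; exact: ltW.
    apply: ler_wpM2r; first by rewrite exprn_ge0 // ltW.
    have h2 : 0 < 1 - p n ^- C by exact: lt_le_trans h1p.
    by apply: ler_pM => //; rewrite ?invr_ge0 ?(ltW h2) // lef_pV2.
  have -> : 4 * c * (q n ^- m * (1 - v)^-1 * Z ^+ 2) = r n / 2.
    rewrite /c /r; field; rewrite !gt_eqF // exprn_gt0 //.
  by have := r_gt0 n; lra.
have px n : p n <= x n by have [/andP[]] := xP n.
(* The right end [p n + r n] equals [q n - T n.+1], which is less than [q n.+1 - T n.+1 = p n.+1];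
   this keeps the order. *)
have xpr n : x n <= q n - T n.+1.
  by have [/andP[_ + _]] := xP n; rewrite /p (TS n); lra.
have xE n e : monomial (nth 0 (mkseq x n)) n e = monomial x n e.
  by apply: eq_bigr => i _; rewrite nth_mkseq.
exists x, C, c; split; split => //.
- by rewrite muln_gt0.
- by move=> n; apply: lt_le_trans (px n).
- move=> n; apply: le_lt_trans (xpr n) _; apply: lt_le_trans (px n.+1).
  by rewrite /p ltrD2r.
- move=> n; apply: le_trans (px n); rewrite /p.
  by have := T_le_delta n; have := delta_le1; lra.
- move=> n; have h1 := px n; have h2 := xpr n; have h3 := T_ge0 n.+1; have h4 := T_le n.
  rewrite ger0_norm; last by lra.
  apply: le_trans (_ : T n <= _); first by move: h1; rewrite /p; lra.
  by apply: le_trans h4 _; rewrite ler_piMl // invr_ge0 exprn_ge0 // ltW.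
by move=> n k e f; have [_ /(_ k e f)] := xP n; rewrite !xE.
Qed.
End Perturbation.

(** * Assembling the perturbed system *)

Theorem theorem1p2 (R : realType) (q : nat -> R) :
  beurling_primes q -> 1 < q 0%N -> abscissa_finite q ->
  forall A : R, 0 < A ->
  exists qt : nat -> R,
    [/\ beurling_primes qt,
        (forall n, `| q n - qt n | <= q n `^ (- A)) &
        exists nu, enum_beurling_ints qt nu /\ bohr_condition nu].
Proof.
move=> [q_incr q1 q_infty _] _ zeta A A0.
have [S [K sumK]] := sum_primes_bounded q_incr q1 zeta.
(* An integer above [A]; as [q n > 1], the bound [q n ^- M] is stronger than the required one. *)
pose M := Num.bound A.
have ltAM : A < M%:R by rewrite /M archi_boundP // ltW.
have M0 : (0 < M)%N by rewrite -(ltr0n R) (lt_trans A0).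
have [qt [C [c [[C0 c0 qt1 qt_incr] [qt_ge qt_close step]]]]] :=
  exists_separated_perturbation q_incr q1 sumK M0.
have qt_infty B : exists N, forall n, (N <= n)%N -> B < qt n.
  have [N hN] := q_infty (B + 1); exists N => n /hN.
  by have := qt_ge n; lra.
have sep := separated_monomials c0 (fun i => ltW (qt1 i)) step.
exists qt; split.
- split=> //; apply: lin_indep_of_separated => // n e f /sep; apply: contraTneq => ->.
  have h : 0 < monomial qt n f.
    by apply: lt_le_trans ltr01 _; apply: monomial_ge1 => i _; exact: ltW.
  by rewrite subrr normr0 -ltNge mulr_gt0 // invr_gt0 exprn_gt0 // mulr_gt0.
- move=> n; apply: le_trans (qt_close n) _; have q0 : 0 < q n by apply: lt_trans (q1 n).
  rewrite -powR_mulrn ?(ltW q0) // -powRN; apply: ler_powR; first exact: ltW.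
  by rewrite lerN2 ltW.
have [nu nuP] := exists_enum_beurling_ints qt1 qt_incr qt_infty.
by exists nu; split=> //; exact: (bohr_of_separated qt1 c0 C0 sep nuP).
Qed.
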